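(* Let $p\ge1$ and let $\gamma_1,\dots,\gamma_p>0$ be fixed. Let $\hat K_1,\hat K_2\in\hat{\mathcal K}_{h,i}$ be two elements sharing the face $\hat F$, with face normal $n_{\hat F}$. Then there is a constant $C$ independent of $h$ such that for all $\hat v\in\hat V_{h,i}|_{\hat K_1\cup\hat K_2}$ $$\|\hat\nabla\hat v\|^2_{\hat K_1}\le C\big(\|\hat\nabla\hat v\|^2_{\hat K_2}+\|\hat v\|^2_{j_{h,\hat F}}\big),$$ $$\|\hat v\|^2_{\hat K_1}\le C\big(\|\hat v\|^2_{\hat K_2}+h^2\|\hat v\|^2_{j_{h,\hat F}}\big).$$
   Context: $\hat{\mathcal K}_{h,i,0}$ is a uniform structured tensor product (square) mesh of $[0,1]^2$ with mesh size $h$; for a reference patch $\hat\Omega_i\subset[0,1]^2$ the active mesh is $\hat{\mathcal K}_{h,i}=\{\hat K\in\hat{\mathcal K}_{h,i,0}:\hat K\cap\hat\Omega_i\ne\emptyset\}$. $\hat V_{h,i}$ is the space of continuous piecewise tensor product polynomials of order $p$ on $\hat{\mathcal K}_{h,i,0}$, restricted to the active mesh. $\|\cdot\|_\omega$ is the $L^2(\omega)$ norm and $\hat\nabla$ the Euclidean gradient in $\mathbb R^2$. For a face (or set of faces) $\hat{\mathcal F}$, $$\|\hat v\|^2_{j_{h,\hat{\mathcal F}}}=\sum_{k=1}^p\gamma_kh^{2k-1}\|\llbracket\hat D_n^k\hat v\rrbracket\|^2_{\hat{\mathcal F}},$$ where $\llbracket\cdot\rrbracket$ is the jump across the face and $\hat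 D_n^k$ the $k$-th derivative in the Euclidean face normal direction. *)

(* Defs.v *)
From HB Require Import structures.
From mathcomp Require Import all_boot all_order all_algebra.
From mathcomp Require Import all_classical all_reals all_analysis.

Set Implicit Arguments.
Unset Strict Implicit.
Unset Printing Implicit Defensive.

Import Order.TTheory GRing.Theory Num.Theory.
Import numFieldNormedType.Exports.

Local Open Scope classical_set_scope.
Local Open Scope ring_scope.

Section Mesh.
Context {R : realType}.

(* A uniform mesh of the unit square has mesh size 1 / N for some N > 0. *)
Definition mesh_size (N : nat) : R := N%:R^-1.

Definition unit_square : set (R * R) := `[0, 1] `*` `[0, 1].

Definition vertex (N i j : nat) : R * R :=
  (i%:R * mesh_size N, j%:R * mesh_size N).

Definition cell (N i j : nat) : set (R * R) :=
  `[(vertex N i j).1, (vertex N i.+1 j).1] `*`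
  `[(vertex N i j).2, (vertex N i j.+1).2].

Definition mesh (N : nat) : set (set (R * R)) :=
  [set K | exists i j, [/\ (i < N)%N, (j < N)%N & K = cell N i j]].

Definition active_mesh (Omega : set (R * R)) (N : nat) : set (set (R * R)) :=
  [set K | mesh N K /\ K `&` Omega !=set0].

(* A face is given by its lower left endpoint [vertex N i j] and the coordinate
   axis its normal is parallel to.  The unit normal is oriented along the
   positive axis: reversing it only changes the sign of the jumps below. *)
Record face := Face { normal_to_x : bool ; face_i : nat ; face_j : nat }.

Definition e1 : R * R := (1, 0).
Definition e2 : R * R := (0, 1).

Definition normal (F : face) : R * R := if normal_to_x F then e1 else e2.
Definition tangent (F : face) : R * R := if normal_to_x F then e2 else e1.

Definition face_point (N : nat) (F : face) (s : R) : R * R :=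
  vertex N (face_i F) (face_j F) + s *: tangent F.

Definition face_set (N : nat) (F : face) : set (R * R) :=
  face_point N F @` `[0, mesh_size N].

(* Tensor product polynomials: degree at most [p] in each variable. *)
Definition tensor_poly (p : nat) (c : 'M[R]_p.+1) (x : R * R) : R :=
  \sum_(i < p.+1) \sum_(j < p.+1) c i j * x.1 ^+ i * x.2 ^+ j.

(* Values outside the unit square are unconstrained here;
   they are discarded by [restrict_space]. *)
Definition full_space (p N : nat) : set (R * R -> R) :=
  [set v | {within unit_square, continuous v} /\
    forall K, mesh N K ->
      exists c : 'M[R]_p.+1, {in K, v =1 tensor_poly c}].

(* A function on [A] is represented by its extension by zero [v \_ A]. *)
Definition restrict_space (A : set (R * R)) (V : set (R * R -> R)) :
  set (R * R -> R) := [set v \_ A | v in V].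

Definition active_space (p : nat) (Omega : set (R * R)) (N : nat) :
    set (R * R -> R) :=
  restrict_space (\bigcup_(K in active_mesh Omega N) K) (full_space p N).

End Mesh.

Section Norms.
Context {R : realType}.

Definition L2norm d (T : measurableType d) (mu : {measure set T -> \bar R})
  (A : set T) (f : T -> R) : \bar R := Lnorm mu 2%:E ((EFin \o f) \_ A).

Definition lebesgue2 :
    {measure set (measurableTypeR R * measurableTypeR R) -> \bar R} :=
  (@lebesgue_measure R \x @lebesgue_measure R)%E.

Definition L2norm_cell (K : set (R * R)) (v : R * R -> R) : \bar R :=
  L2norm lebesgue2 K v.

Definition grad_length (v : R * R -> R) (x : R * R) : R :=
  Num.sqrt (('D_e1 v x) ^+ 2 + ('D_e2 v x) ^+ 2).

(* The gradient is the elementwise one, so it is taken on the interior of the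
   cell; the boundary of a cell is a null set. *)
Definition L2norm_grad (K : set (R * R)) (v : R * R -> R) : \bar R :=
  L2norm lebesgue2 K° (grad_length v).

Definition normal_derive (F : face) (k : nat) (v : R * R -> R) : R * R -> R :=
  iter k (fun w x => 'D_(normal F) w x) v.

Definition jump (F : face) (w : R * R -> R) (x : R * R) : R :=
  lim (w (x + t *: normal F) @[t --> 0^'+]) -
  lim (w (x - t *: normal F) @[t --> 0^'+]).

(* [face_point N F] is an arc length parametrization of the face. *)
Definition L2norm_face (N : nat) (F : face) (g : R * R -> R) : \bar R :=
  L2norm (@lebesgue_measure R) `[0, mesh_size N] (g \o face_point N F).

(* The square of the seminorm $\|v\|_{j_{h,F}}$. *)
Definition sqr_jump_norm (p : nat) (gamma : nat -> R) (N : nat) (F : face)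
    (v : R * R -> R) : \bar R :=
  (\sum_(1 <= k < p.+1) (gamma k * mesh_size N ^+ (2 * k - 1))%:E *
     L2norm_face N F (jump F (normal_derive F k v)) ^+ 2)%E.

End Norms.

(* Main.v *)
(** Choose coordinates s = (x - a) / h and t = (y - b) / h centred at an endpoint
    (a, b) of the face.  In these coordinates v is a tensor product polynomial on
    each of K_1 and K_2, with coefficient matrices d_1 and d_2.  On a unit cell
    the L^2 norm of a polynomial is equivalent to the Euclidean norm of its
    coefficients, so ||v||^2 on K_l compares with h^2 |d_l|^2, and the squared
    gradient norm with the coefficients of the partial derivatives of d_l, which
    depend linearly on d_l.  If the face normal is the s-direction, the k-th
    normal jump is k! h^-k sum_j (d_1 - d_2)_kj t^j up to sign, and the (k = 0)-rows
    agree by continuity; the powers of h in the jump seminorm are exactly those for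
    which it dominates |d_1 - d_2|^2.  Both estimates then follow from
    |d_1|^2 <= 2 |d_2|^2 + 2 |d_1 - d_2|^2. *)

From HB Require Import structures.
Require Import Defs.
From mathcomp Require Import all_boot all_order all_algebra.
From mathcomp Require Import all_classical all_reals all_analysis.
From mathcomp Require Import measurable_realfun.
From mathcomp Require Import ring lra zify.

Set Implicit Arguments.
Unset Strict Implicit.
Unset Printing Implicit Defensive.

Import Order.TTheory GRing.Theory Num.Theory.
Import numFieldNormedType.Exports.

Local Open Scope classical_set_scope.
Local Open Scope ring_scope.

(** * Polynomials in one variable on a unit interval *)

(** Cauchy-Schwarz by Lagrange's identity: twice the difference of the two sides is the double sum
    of the squares [(a i * b j - a j * b i) ^+ 2]. *)
Lemma sqr_sum_mul_le (R : realDomainType) (I : finType) (a b : I -> R) :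
  (\sum_i a i * b i) ^+ 2 <= (\sum_i a i ^+ 2) * (\sum_i b i ^+ 2).
Proof.
set A := \sum_i a i ^+ 2; set B := \sum_i b i ^+ 2; set S := \sum_i a i * b i.
rewrite -subr_ge0 -(pmulrn_lge0 _ (ltn0Sn 1)).
suff -> : (A * B - S ^+ 2) *+ 2 = \sum_i \sum_j (a i * b j - a j * b i) ^+ 2.
  by do 2 (apply: sumr_ge0 => ? _); exact: sqr_ge0.
have -> : (A * B - S ^+ 2) *+ 2 = A * B + B * A - (S * S + S * S) by ring.
rewrite !big_distrlr/= -!big_split/= -sumrB; apply: eq_bigr => i _.
by rewrite -!big_split/= -sumrB; apply: eq_bigr => j _; ring.
Qed.

Section OneDimension.
Context {R : realType}.
Implicit Types (q : {poly R}) (n : nat).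

(* The constant term is [q`_0 / 0 = 0]. *)
Definition primitive q : {poly R} :=
  \poly_(i < (size q).+1) (q`_i.-1 / i%:R).

Lemma coef_primitive q i : (primitive q)`_i = q`_i.-1 / i%:R.
Proof.
rewrite coef_poly; case: ltnP => // szi; case: i szi => [|i] szi.
  by rewrite invr0 mulr0.
by rewrite nth_default ?mul0r.
Qed.

Lemma deriv_primitive q : (primitive q)^`() = q.
Proof.
apply/polyP => i; rewrite coef_deriv coef_primitive -[LHS]mulr_natr.
by rewrite /= divfK// pnatr_eq0.
Qed.

Lemma primitive_is_linear : linear primitive.
Proof.
move=> c q r; apply/polyP => i.
by rewrite coefD coefZ !coef_primitive coefD coefZ mulrDl mulrA.
Qed.

HB.instance Definition _ :=
  GRing.isLinear.Build R {poly R} {poly R} _ primitive primitive_is_linear.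

Lemma integral_deriv_poly (a b : R) q : a < b ->
  (\int[lebesgue_measure]_(x in `[a, b]) (q^`().[x])%:E =
   (q.[b] - q.[a])%:E)%E.
Proof.
move=> ab; rewrite (@continuous_FTC2 _ _ (horner q))//.
- by apply: continuous_subspaceT; exact: continuous_horner.
- split=> [x _||]; first exact: derivable_horner.
  + by apply: cvg_at_right_filter; exact: continuous_horner.
  + by apply: cvg_at_left_filter; exact: continuous_horner.
- by move=> x _; rewrite derivE.
Qed.

Lemma poly_eq0_segment q (a b : R) : a < b ->
  (forall x, a <= x <= b -> q.[x] = 0) -> q = 0.
Proof.
move=> ab q0; apply/eqP/negPn/negP => qn0.
(* These are [size q] distinct roots in the segment, whereas a nonzero polynomial has fewer roots
   than its size. *)
pose rs := [seq a + (b - a) / k.+1%:R | k <- iota 0 (size q)].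
have ba0 : 0 < b - a by rewrite subr_gt0.
suff : (size rs < size q)%N by rewrite size_map size_iota ltnn.
apply: max_poly_roots => //.
  apply/allP => _ /mapP[k _ ->]; apply/rootP/q0; apply/andP; split.
    by rewrite lerDl divr_ge0// ltW.
  by rewrite -lerBrDl ler_pdivrMr// ler_peMr ?ler1n//; exact: ltW.
rewrite map_inj_uniq ?iota_uniq// => k l /addrI/(mulfI (lt0r_neq0 ba0))/invr_inj.
by move/eqP; rewrite eqr_nat => /eqP[].
Qed.

(** The integral of [q] over [[u, u + 1]], defined through the formal primitive so that linearity in
    [q] is pure algebra. *)
Definition unit_int (u : R) q : R := (primitive q).[u + 1] - (primitive q).[u].

Lemma unit_int_is_linear u : linear_for *%R (unit_int u).
Proof.
move=> c q r; rewrite /unit_int linearP !hornerE/=; ring.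
Qed.

HB.instance Definition _ u :=
  GRing.isLinear.Build R {poly R} R _ (unit_int u) (unit_int_is_linear u).

Lemma integral_unit_int u (a h : R) q : 0 < h ->
  (\int[lebesgue_measure]_(x in `[(a + h * u)%R, (a + h * (u + 1))%R])
      (q.[(x - a) / h])%:E = (h * unit_int u q)%:E)%E.
Proof.
move=> h0; pose L : {poly R} := h^-1 *: ('X - a%:P).
have hn0 : h != 0 by rewrite gt_eqF.
have LE x : L.[x] = (x - a) / h by rewrite /L !hornerE mulrC.
(* By the chain rule [F] is an antiderivative of the integrand, so the substitution reduces to the
   fundamental theorem of calculus. *)
pose F := h *: (primitive q \Po L).
have F'E : F^`() = q \Po L.
  rewrite /F derivZ deriv_comp deriv_primitive /L derivZ derivB derivX derivC.
  by rewrite subr0 alg_polyC mulrC mul_polyC scalerA divff// scale1r.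
transitivity (\int[lebesgue_measure]_(x in `[(a + h * u)%R, (a + h * (u + 1))%R])
    (F^`().[x])%:E)%E.
  by apply: eq_integral => x _; rewrite F'E horner_comp LE.
rewrite integral_deriv_poly; last by nra.
rewrite /F !hornerZ !horner_comp !LE -mulrBr /unit_int.
by congr ((h * (_.[_] - _.[_]))%:E); field.
Qed.

Lemma unit_int_ge0 u q : (forall x, 0 <= q.[x]) -> 0 <= unit_int u q.
Proof.
move=> q0; rewrite -[unit_int u q]mul1r.
rewrite -lee_fin -(@integral_unit_int u 0 1 q ltr01); apply: integral_ge0 => x _.
by rewrite lee_fin.
Qed.

Lemma primitive_ndecr q : (forall x, 0 <= q.[x]) ->
  {homo horner (primitive q) : x y / x <= y}.
Proof.
move=> q0 x y; rewrite le_eqVlt => /predU1P[->//|xy].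
rewrite -subr_ge0 -lee_fin -integral_deriv_poly// deriv_primitive.
by apply: integral_ge0 => z _; rewrite lee_fin.
Qed.

(** The primitive of [q ^+ 2] is nondecreasing and takes equal values at both ends. Hence it is
    constant on the segment, so constant as a polynomial, and its derivative [q ^+ 2] vanishes. *)
Lemma unit_int_sqr_eq0 u q : unit_int u (q ^+ 2) = 0 -> q = 0.
Proof.
move=> /eqP; rewrite subr_eq0 => /eqP Q01.
have Qh := @primitive_ndecr (q ^+ 2) _.
have {}Qh : {homo horner (primitive (q ^+ 2)) : x y / x <= y}.
  by apply: Qh => x; rewrite horner_exp sqr_ge0.
have : primitive (q ^+ 2) - (primitive (q ^+ 2)).[u]%:P = 0.
  apply: (@poly_eq0_segment _ u (u + 1)) => [|x /andP[ux xu]]; first lra.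
  rewrite !hornerE; apply/eqP; rewrite subr_eq0 eq_le.
  by rewrite (Qh u x)// andbT -Q01 Qh.
move/(congr1 (@deriv R)); rewrite derivB deriv_primitive derivC deriv0 subr0.
by move/eqP; rewrite expf_eq0/= => /eqP.
Qed.

(** Cauchy-Schwarz for the inner product given by [unit_int u]: with [g] the integral of [q * r] and
    [w] that of [r ^+ 2], expand the nonnegative integral of [(w *: q - g *: r) ^+ 2] and divide by
    [w]. *)
Lemma unit_int_mul_le u q r :
  unit_int u (q * r) ^+ 2 <= unit_int u (q ^+ 2) * unit_int u (r ^+ 2).
Proof.
have [->|r0] := eqVneq r 0; first by rewrite mulr0 expr0n/= !linear0 mulr0 expr0n.
set g := unit_int u (q * r); set w := unit_int u (r ^+ 2).
have w0 : 0 < w.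
  rewrite lt_neqAle eq_sym unit_int_ge0 ?andbT; last first.
    by move=> x; rewrite horner_exp sqr_ge0.
  by apply: contra r0 => /eqP/unit_int_sqr_eq0 ->.
have : 0 <= unit_int u ((w *: q - g *: r) ^+ 2).
  by apply: unit_int_ge0 => x; rewrite horner_exp sqr_ge0.
have -> : (w *: q - g *: r) ^+ 2 =
    w ^+ 2 *: q ^+ 2 - (w * g) *: (q * r) *+ 2 + g ^+ 2 *: r ^+ 2.
  by rewrite sqrrB !exprZn -scalerAl -scalerAr scalerA.
rewrite linearD linearB linearMn !linearZ/= -/g -/w.
set Q := unit_int _ _ => H.
have : 0 <= w * (w * Q - g ^+ 2) by move: H; congr (0 <= _); rewrite /GRing.scale/=; ring.
by rewrite pmulr_rge0// subr_ge0 mulrC.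
Qed.

(* The Gram matrix of the monomials is invertible, so the coefficients of [q] are
   linear combinations of the moments [unit_int u (q * 'X^j)]. *)
Lemma coef_sqr_le_unit_int n u : exists2 C : R, 0 < C &
  forall q, (size q <= n)%N ->
    \sum_(i < n) q`_i ^+ 2 <= C * unit_int u (q ^+ 2).
Proof.
pose H : 'M[R]_n := \matrix_(i, j) unit_int u ('X^i * 'X^j).
have rowE (d : 'rV[R]_n) j : (d *m H) 0 j = unit_int u (rVpoly d * 'X^j).
  rewrite mxE; under eq_bigr do rewrite mxE.
  rewrite /rVpoly poly_def mulr_suml raddf_sum/=; apply: eq_bigr => i _.
  by rewrite -scalerAl linearZ/= insubT//= => ?; congr (d _ _ * _); exact: val_inj.
(* A row in the kernel of [H] is a polynomial orthogonal to every monomial, hence to itself, so it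
   is zero. *)
have HU : H \in unitmx.
  rewrite -row_free_unit -kermx_eq0; apply/eqP/row_matrixP => i; rewrite row0.
  set d := row i _; have dH : d *m H = 0 by rewrite /d -row_mul mulmx_ker row0.
  suff /unit_int_sqr_eq0 d0 : unit_int u (rVpoly d ^+ 2) = 0.
    by apply: (can_inj (@rVpolyK _ _)); rewrite d0 linear0.
  rewrite expr2 {2}/rVpoly poly_def mulr_sumr raddf_sum big1// => j _.
  by rewrite -scalerAr/= linearZ/= -rowE dH mxE mulr0.
pose B := \sum_(i < n) \sum_(j < n) invmx H j i ^+ 2.
pose W := \sum_(j < n) unit_int u ('X^j ^+ 2).
have sqr_int_ge0 r : 0 <= unit_int u (r ^+ 2).
  by apply: unit_int_ge0 => x; rewrite horner_exp sqr_ge0.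
have B0 : 0 <= B by do 2 (apply: sumr_ge0 => ? _); exact: sqr_ge0.
have W0 : 0 <= W by exact: sumr_ge0.
(* [B] comes from Cauchy-Schwarz in the product with the inverse Gram matrix, [W] from bounding each
   moment by [unit_int_mul_le]. Adding 1 makes the constant positive. *)
exists (B * W + 1) => [|q szq]; first by rewrite ltr_wpDl// mulr_ge0.
pose d : 'rV[R]_n := poly_rV q.
have dE : d = d *m H *m invmx H by rewrite mulmxK.
have gE j : (d *m H) 0 j ^+ 2 <= unit_int u (q ^+ 2) * unit_int u ('X^j ^+ 2).
  by rewrite rowE poly_rV_K// unit_int_mul_le.
apply: (@le_trans _ _ (B * (W * unit_int u (q ^+ 2)))); last first.
  by rewrite mulrA ler_wpM2r// lerDl.
rewrite mulr_suml; apply: ler_sum => i _.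
have -> : q`_i = d 0 i by rewrite mxE.
rewrite dE mxE mulrC; apply: (le_trans (sqr_sum_mul_le _ _)).
rewrite ler_wpM2r//; first by apply: sumr_ge0 => j _; exact: sqr_ge0.
by rewrite mulr_suml; apply: ler_sum => j _; rewrite mulrC.
Qed.

End OneDimension.

(** * Integrals over boxes *)

Section Norms.
Context {R : realType}.

Lemma L2norm_sqr d (T : measurableType d) (mu : {measure set T -> \bar R})
    (A : set T) (f : T -> R) :
  (L2norm mu A f ^+ 2 = \int[mu]_(x in A) (f x ^+ 2)%:E)%E.
Proof.
rewrite /L2norm unlock.
set I := (\int[mu]_x _)%E.
have I0 : (0 <= I)%E by apply: integral_ge0 => x _; exact: poweR_ge0.
rewrite poweR12_sqrt// sqr_sqrte// /I.
rewrite [RHS]integral_mkcond; apply: eq_integral => x _.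
rewrite /= !patchE; case: ifPn => _ /=; last by rewrite normr0 powR0.
by rewrite powR_mulrn// real_normK ?num_real.
Qed.

Lemma measurable_horner_affine (q : {poly R}) (a h : R) :
  measurable_fun [set: R] (fun x => q.[(x - a) / h]).
Proof.
apply: (@measurableT_comp _ _ _ _ _ _ (horner q)).
  by apply: continuous_measurable_fun; exact: continuous_horner.
by apply: measurable_funM => //; exact: measurable_funB.
Qed.

(** Rescaling to the unit interval produces the factor [h], so [m] depends on [n] and [u] only. The
    interval is open to suit the gradient norm, which lives on the interior of a cell. *)
Lemma integral_interval_ge n u : exists2 m : R, 0 < m &
  forall (a h : R) (q : {poly R}), 0 < h -> (size q <= n)%N ->
  ((m * h * \sum_(i < n) q`_i ^+ 2)%:E <=
   \int[lebesgue_measure]_(x in `](a + h * u)%R, (a + h * (u + 1))%R[)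
     (q.[(x - a) / h] ^+ 2)%:E)%E.
Proof.
have [C C0 HC] := @coef_sqr_le_unit_int R n u.
exists C^-1 => [|a h q h0 szq]; first by rewrite invr_gt0.
rewrite -(@integral_itv_bndoo _ _ _ _ true false); last first.
  apply/measurable_EFinP; apply: measurable_funX.
  by apply: measurable_funTS; exact: measurable_horner_affine.
under eq_integral do rewrite -horner_exp.
rewrite (@integral_unit_int R u a h (q ^+ 2) h0) lee_fin.
by rewrite mulrAC mulrC ler_pM2l// ler_pdivrMl// HC.
Qed.

(** The square of the Frobenius norm. *)
Definition coef_norm m n (d : 'M[R]_(m, n)) : R := \sum_i \sum_j d i j ^+ 2.

Lemma coef_norm_ge0 m n (d : 'M[R]_(m, n)) : 0 <= coef_norm d.
Proof. by do 2 (apply: sumr_ge0 => ? _); exact: sqr_ge0. Qed.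

Lemma coef_normD_le m n (c d : 'M[R]_(m, n)) :
  coef_norm (c + d) <= 2 * coef_norm c + 2 * coef_norm d.
Proof.
rewrite /coef_norm !mulr_sumr -big_split; apply: ler_sum => i _ /=.
rewrite !mulr_sumr -big_split; apply: ler_sum => j _ /=.
by rewrite mxE; have := sqr_ge0 (c i j - d i j); nra.
Qed.

Lemma coef_norm_mulmx_le m n k (c : 'M[R]_(m, n)) (d : 'M[R]_(n, k)) :
  coef_norm (c *m d) <= coef_norm c * coef_norm d.
Proof.
rewrite /coef_norm (exchange_big _ _ _ _ _ (fun i j => d i j ^+ 2)) big_distrlr/=.
apply: ler_sum => i _; apply: ler_sum => j _.
by rewrite mxE; exact: sqr_sum_mul_le.
Qed.

Lemma coef_normN m n (d : 'M[R]_(m, n)) : coef_norm (- d) = coef_norm d.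
Proof. by do 2 (apply: eq_bigr => ? _); rewrite mxE sqrrN. Qed.

Variable p : nat.
Implicit Types (d : 'M[R]_p.+1) (a b h : R).

(** Cauchy-Schwarz against the [p.+1 * p.+1] monomials, each of absolute value at most 1 at [x]. *)
Lemma sqr_tensor_poly_le d (x : R * R) : `|x.1| <= 1 -> `|x.2| <= 1 ->
  tensor_poly d x ^+ 2 <= (p.+1 * p.+1)%:R * coef_norm d.
Proof.
move=> x1 x2; rewrite /tensor_poly pair_big/=.
under eq_bigr do rewrite -mulrA.
apply: (le_trans (sqr_sum_mul_le _ _)).
rewrite -(pair_big predT predT (fun i j => d i j ^+ 2))/= mulrC.
rewrite ler_wpM2r ?coef_norm_ge0//.
apply: (@le_trans _ _ (\sum_(ij : 'I_p.+1 * 'I_p.+1) 1)).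
  apply: ler_sum => -[i j] _ /=.
  by rewrite -real_normK ?num_real// expr_le1// normrM !normrX mulr_ile1// exprn_ile1.
by rewrite sumr_const card_prod card_ord.
Qed.

Definition scaled a b h (x : R * R) : R * R := ((x.1 - a) / h, (x.2 - b) / h).

Lemma measurable_tensor_poly d a b h :
  measurable_fun [set: measurableTypeR R * measurableTypeR R]
    (fun x => tensor_poly d (scaled a b h x)).
Proof.
apply: measurable_sum => i; apply: measurable_sum => j /=.
apply: measurable_funM; first apply: measurable_funM => //.
- apply: measurable_funX; apply: measurable_funM => //.
  by apply: measurable_funB => //; exact: measurable_fst.
- apply: measurable_funX; apply: measurable_funM => //.
  by apply: measurable_funB => //; exact: measurable_snd.
Qed.

Definition open_box a b h u w : set (R * R) :=
  `](a + h * u), (a + h * (u + 1))[ `*` `](b + h * w), (b + h * (w + 1))[.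

Definition closed_box a b h u w : set (R * R) :=
  `[(a + h * u), (a + h * (u + 1))] `*` `[(b + h * w), (b + h * (w + 1))].

Lemma interior_setX (T U : topologicalType) (A : set T) (B : set U) :
  (A `*` B)° = A° `*` B°.
Proof.
apply/seteqP; split => -[x y].
  move=> [[P Q]/= [xP yQ] PQ]; split => /=.
    by apply: filterS xP => z Pz; have [] := PQ (z, y) (conj Pz (nbhs_singleton yQ)).
  by apply: filterS yQ => z Qz; have [] := PQ (x, z) (conj (nbhs_singleton xP) Qz).
by move=> [xA yB]; exists (A, B).
Qed.

Lemma interior_closed_box a b h u w :
  (closed_box a b h u w)° = open_box a b h u w.
Proof. by rewrite interior_setX !interior_itv_bnd. Qed.

(** By Tonelli the one-variable bound applies twice: in the second variable for fixed [x], where the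
    coefficients are the values of the polynomials [q j] at [x], and then in the first variable to
    each [q j]. The constant is the product of the two one-variable constants. *)
Lemma integral_box_ge u w : exists2 m : R, 0 < m &
  forall a b h d, 0 < h ->
  ((m * h ^+ 2 * coef_norm d)%:E <=
   \int[lebesgue2]_(x in open_box a b h u w)
     (tensor_poly d (scaled a b h x) ^+ 2)%:E)%E.
Proof.
have [mu mu0 Hu] := integral_interval_ge p.+1 u.
have [mw mw0 Hw] := integral_interval_ge p.+1 w.
exists (mu * mw) => [|a b h d h0]; first exact: mulr_gt0.
pose f x := (tensor_poly d (scaled a b h x) ^+ 2)%:E.
set D := open_box a b h u w.
have mD : measurable (D : set (measurableTypeR R * measurableTypeR R)).
  by apply: measurableX; exact: measurable_itv.
have mf : measurable_fun [set: measurableTypeR R * measurableTypeR R] f.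
  by apply/measurable_EFinP; apply: measurable_funX; exact: measurable_tensor_poly.
have f0 x : (0 <= (f \_ D) x)%E.
  by rewrite patchE; case: ifPn => // _; rewrite lee_fin sqr_ge0.
have mfD : measurable_fun setT (f \_ D).
  by apply/(measurable_restrictT _ mD); exact: measurable_funTS.
rewrite integral_mkcond fubini_tonelli1//.
set A := `](a + h * u), (a + h * (u + 1))[%classic.
set B := `](b + h * w), (b + h * (w + 1))[%classic.
(* [q j] is the coefficient of the [j]-th power of the second variable, as a polynomial in the
   first. *)
pose q (j : 'I_p.+1) : {poly R} := \poly_(i < p.+1) d (inord i) j.
have szq j : (size (q j) <= p.+1)%N by exact: size_poly.
pose g x := \sum_j (q j).[(x - a) / h] ^+ 2.
have mq j : measurable_fun [set: R] (fun x => (q j).[(x - a) / h] ^+ 2).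
  by apply: measurable_funX; exact: measurable_horner_affine.
have mA : measurable (A : set (measurableTypeR R)) by exact: measurable_itv.
have inner x : A x ->
    ((mw * h * g x)%:E <= fubini_F lebesgue_measure (f \_ D) x)%E.
  move=> Ax; pose r : {poly R} := \poly_(j < p.+1) (q (inord j)).[(x - a) / h].
  have := Hw b h r h0 (size_poly _ _).
  have -> : \sum_(j < p.+1) r`_j ^+ 2 = g x.
    by apply: eq_bigr => j _; rewrite coef_poly ltn_ord inord_val.
  move=> /le_trans; apply; rewrite /fubini_F [leLHS]integral_mkcond.
  apply: ge0_le_integral => //.
  - by move=> y _; rewrite patchE; case: ifPn => // _; rewrite lee_fin sqr_ge0.
  - apply/(measurable_restrictT _ (measurable_itv _))/measurable_funTS.
    apply/measurable_EFinP; apply: measurable_funX.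
    exact: measurable_horner_affine.
  - by apply: measurableT_comp => //; exact: measurable_pair1.
  - move=> y _; rewrite !patchE; case: ifPn => [yB|_]; last exact: f0.
    have -> : (x, y) \in D by rewrite inE; split=> //=; move: yB; rewrite inE.
    rewrite lee_fin /f /tensor_poly/= /r horner_poly exchange_big/=.
    rewrite le_eqVlt; apply/orP; left; apply/eqP; congr (_ ^+ 2).
    apply: eq_bigr => j _; rewrite inord_val /q horner_poly mulr_suml.
    by apply: eq_bigr => i _; rewrite inord_val.
apply: (@le_trans _ _ (\int[lebesgue_measure]_(x in A) (mw * h * g x)%:E)%E); last first.
  apply: (@le_trans _ _ (\int[lebesgue_measure]_(x in A)
      fubini_F lebesgue_measure (f \_ D) x)%E).
    apply: ge0_le_integral => //.
    - move=> x _; rewrite lee_fin mulr_ge0 ?(mulr_ge0 (ltW mw0) (ltW h0))//.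
      by apply: sumr_ge0 => j _; exact: sqr_ge0.
    - apply/measurable_EFinP; apply: measurable_funTS; apply: measurable_funM => //.
      by apply: measurable_sum => j; exact: mq.
    - by apply: measurable_funTS; exact: measurable_fun_fubini_tonelli_F.
  apply: ge0_subset_integral => //.
  - exact: measurable_fun_fubini_tonelli_F.
  - by move=> x _; apply: integral_ge0.
under eq_integral do rewrite EFinM -sumEFin.
rewrite ge0_integralZl//; last 3 first.
- apply: measurable_funTS; apply: emeasurable_sum => j.
  by apply/measurable_EFinP; exact: mq.
- by move=> x _; apply: sume_ge0 => j _; rewrite lee_fin sqr_ge0.
- by rewrite lee_fin mulr_ge0// ltW.
rewrite ge0_integral_sum//; last 2 first.
- by move=> j; apply: measurable_funTS; apply/measurable_EFinP; exact: mq.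
- by move=> j x _; rewrite lee_fin sqr_ge0.
apply: (@le_trans _ _ ((mw * h)%:E *
    \sum_j (mu * h * \sum_(i < p.+1) (q j)`_i ^+ 2)%:E)%E); last first.
  apply: lee_wpmul2l; first by rewrite lee_fin mulr_ge0// ltW.
  by apply: lee_sum => j _; exact: Hu.
rewrite sumEFin -EFinM lee_fin -mulr_sumr /coef_norm exchange_big/=.
rewrite le_eqVlt; apply/orP; left; apply/eqP.
rewrite [in RHS](eq_bigr (fun j => \sum_i d i j ^+ 2)); first by ring.
by move=> j _; apply: eq_bigr => i _; rewrite coef_poly ltn_ord inord_val.
Qed.

Lemma integral_box_le u w a b h (K : set (R * R)) (C : R) (f : R * R -> R) : 0 < h ->
  K = open_box a b h u w \/ K = closed_box a b h u w ->
  measurable_fun [set: measurableTypeR R * measurableTypeR R] f ->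
  (forall x, K x -> 0 <= f x <= C) ->
  (\int[lebesgue2]_(x in K) (f x)%:E <= (C * h ^+ 2)%:E)%E.
Proof.
move=> h0 KE mf fC.
have [mK ->] : measurable (K : set (measurableTypeR R * measurableTypeR R)) /\
    (C * h ^+ 2)%:E = (C%:E * lebesgue2 K)%E.
  have lambda_itv c z (b0 b1 : bool) : @lebesgue_measure R
      [set` Interval (BSide b0 (c + h * z)) (BSide b1 (c + h * (z + 1)))] = h%:E.
    rewrite lebesgue_measure_itv/= lte_fin ltrD2l ltr_pM2l// ltrDl ltr01 -EFinB.
    by congr (_%:E); ring.
  have lambda2_box (b0 b1 : bool) :
      let I c z := [set` Interval (BSide b0 (c + h * z)) (BSide b1 (c + h * (z + 1)))] in
      measurable (I a u `*` I b w : set (measurableTypeR R * measurableTypeR R)) /\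
      (C * h ^+ 2)%:E = (C%:E * lebesgue2 (I a u `*` I b w))%E.
    move=> I; have mI c z : measurable (I c z : set (measurableTypeR R)).
      exact: measurable_itv.
    split; first exact: measurableX.
    have -> : lebesgue2 (I a u `*` I b w) =
        (lebesgue_measure (I a u) * lebesgue_measure (I b w))%E.
      exact: product_measure1E.
    by rewrite /I !lambda_itv -!EFinM.
  by case: KE => ->; exact: lambda2_box.
rewrite -integral_cst//; apply: ge0_le_integral => //.
- by move=> x /fC/andP[fx _]; rewrite lee_fin.
- by apply/measurable_EFinP; exact: measurable_funTS.
- by move=> x /fC/andP[_ fx]; rewrite lee_fin.
Qed.

End Norms.

(** * Tensor product polynomials and their derivatives along lines *)

Section TensorPoly.
Context {R : realType}.
Variable p : nat.
Implicit Types (c d : 'M[R]_p.+1) (a b h s t : R).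

Definition monomials s : 'rV[R]_p.+1 := \row_i s ^+ i.

(** As a bilinear form in monomial vectors, the polynomial undergoes affine substitutions and
    partial derivatives through matrix products on either side of [d]. *)
Lemma tensor_polyE d s t :
  tensor_poly d (s, t) = (monomials s *m d *m (monomials t)^T) 0 0.
Proof.
rewrite mxE /tensor_poly exchange_big/=; apply: eq_bigr => j _.
by rewrite !mxE mulr_suml; apply: eq_bigr => i _; rewrite !mxE; ring.
Qed.

Lemma tensor_poly_tr d s t : tensor_poly d^T (s, t) = tensor_poly d (t, s).
Proof. by rewrite !tensor_polyE -(trmxK (_ *m _)) [LHS]mxE !trmx_mul !trmxK mulmxA. Qed.

Lemma tensor_polyB c d (x : R * R) :
  tensor_poly (c - d) x = tensor_poly c x - tensor_poly d x.
Proof.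
by case: x => s t; rewrite !tensor_polyE mulmxBr mulmxBl !mxE.
Qed.

Lemma coef_norm_tr d : coef_norm d^T = coef_norm d.
Proof.
rewrite /coef_norm exchange_big; apply: eq_bigr => i _.
by apply: eq_bigr => j _; rewrite mxE.
Qed.

(** The binomial coefficients of [(a + h * s) ^+ i]. For [k > i] the truncated difference [i - k] is
    harmless, because the binomial coefficient is 0. *)
Definition affine_mx a h : 'M[R]_p.+1 :=
  \matrix_(k, i) (a ^+ (i - k) * h ^+ k *+ 'C(i, k)).

Lemma monomials_affine a h s :
  monomials (a + h * s) = monomials s *m affine_mx a h.
Proof.
apply/rowP => i; rewrite !mxE exprDn.
rewrite (big_ord_widen _ (fun k => a ^+ (i - k) * (h * s) ^+ k *+ 'C(i, k)) (ltn_ord i)).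
rewrite big_mkcond; apply: eq_bigr => k _; rewrite !mxE ltnS.
case: leqP => ik; last by rewrite bin_small// !mulr0n mulr0.
by rewrite exprMn mulrnAr; congr (_ *+ _); ring.
Qed.

Lemma tensor_poly_scaled c a b h : h != 0 ->
  exists d, forall x, tensor_poly c x = tensor_poly d (scaled a b h x).
Proof.
move=> h0; exists (affine_mx a h *m c *m (affine_mx b h)^T) => -[x y].
have E r z : z = r + h * ((z - r) / h) by field.
rewrite {1}(E a x) {1}(E b y) /scaled/= !tensor_polyE !monomials_affine.
by rewrite trmx_mul !mulmxA.
Qed.

(** Differentiation on coefficients: multiplying [d] by it on the left differentiates in the first
    variable, and multiplying by its transpose on the right in the second. *)
Definition deriv_mx : 'M[R]_p.+1 := \matrix_(i, k) ((k == i.+1 :> nat) * k)%:R.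

Lemma monomials_deriv s k : (monomials s *m deriv_mx) 0 k = s ^+ k.-1 *+ k.
Proof.
rewrite mxE; case: k => -[|k] kp /=.
  by rewrite big1// => i _; rewrite !mxE muln0 mulr0.
rewrite (bigD1 (Ordinal (ltnW kp)))//= big1 => [|i ik]; rewrite !mxE/=.
  by rewrite eqxx mul1n addr0 mulr_natr.
by rewrite eqSS eq_sym (negbTE (_ : i != k :> nat)) ?mul0n ?mulr0.
Qed.

(** The restriction of the scaled polynomial to a line along the first axis, as a polynomial in the
    unscaled displacement from [(s, t)]. Directional derivatives thus become formal ones and carry
    their powers of [h^-1]. *)
Definition line_poly d h s t : {poly R} :=
  \sum_(i < p.+1) ((d *m (monomials t)^T) i 0) *: (s%:P + h^-1 *: 'X) ^+ i.

Lemma line_polyE d h s t r :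
  (line_poly d h s t).[r] = tensor_poly d (s + r / h, t).
Proof.
rewrite tensor_polyE -mulmxA [RHS]mxE /line_poly horner_sum.
apply: eq_bigr => i _; rewrite !hornerE !mxE mulrC.
by rewrite (mulrC _ r).
Qed.

Lemma deriv_line_poly d h s t :
  (line_poly d h s t)^`().[0] = h^-1 * tensor_poly (deriv_mx *m d) (s, t).
Proof.
rewrite tensor_polyE mulmxA -mulmxA [in RHS]mxE /line_poly raddf_sum horner_sum.
rewrite mulr_sumr; apply: eq_bigr => i _; rewrite monomials_deriv.
rewrite /= derivZ deriv_exp derivD derivC add0r derivZ derivX alg_polyC.
rewrite mul_polyC hornerZ hornerMn hornerZ horner_exp !hornerE.
by rewrite -[in LHS]mulr_natr -[in RHS]mulr_natr/=; ring.
Qed.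

Lemma derivn_line_poly d h t (k : 'I_p.+1) : (line_poly d h 0 t)^`(k).[0] =
  \sum_(j < p.+1) (k`!%:R * h ^- k * d k j) * t ^+ j.
Proof.
have -> : line_poly d h 0 t =
    \poly_(i < p.+1) (h ^- i * (d *m (monomials t)^T) (inord i) 0).
  rewrite /line_poly poly_def; apply: eq_bigr => i _.
  by rewrite add0r exprZn scalerA inord_val exprVn mulrC.
rewrite horner_coef0 coef_derivn addn0 coef_poly ltn_ord ffactnn inord_val.
rewrite -[LHS]mulr_natl mulrA mxE mulr_sumr; apply: eq_bigr => j _.
by rewrite !mxE mulrA.
Qed.

End TensorPoly.

Section Lines.
Context {R : realType}.
Implicit Types (x n : R * R) (q : {poly R}).

Lemma derive_line (v : R * R -> R) x n q (r : R) :
  (\forall s \near r, v (x + s *: n) = q.[s]) ->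
  'D_n v (x + r *: n) = q^`().[r].
Proof.
move=> vq; rewrite derivE derive1E.
have <- : 'D_1 (fun s : R => v (x + s *: n)) r = 'D_1 (horner q) r.
  exact: near_eq_derive.
rewrite /derive; set f := (X in lim (X @ _) = _); set g := (X in _ = lim (X @ _)).
suff -> : f = g by [].
by apply/funext => h; rewrite /f /g/= scalerDl [h%:A]mulr1 addrCA.
Qed.

(** An open interval is a neighbourhood of each of its points, so agreement with a polynomial passes
    to the derivative and the induction on [k] goes through. *)
Lemma normal_derive_line F (v : R * R -> R) x q (l r : R) k :
  (forall s : R, l < s < r -> v (x + s *: normal F) = q.[s]) ->
  forall s : R, l < s < r ->
    normal_derive F k v (x + s *: normal F) = q^`(k).[s].
Proof.
move=> vq; elim: k => [|k IH] s lsr; first by rewrite derivn0; exact: vq.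
rewrite derivnS; apply: derive_line.
near=> z; apply: IH; near: z.
have : s \in `]l, r[ by rewrite in_itv.
move=> /near_in_itvoo; apply: filterS => z; by rewrite in_itv.
Unshelve. all: by end_near. Qed.

(** Only one-sided limits enter the jump, so it suffices to know [v] strictly on either side of the
    face; the derivatives there extend continuously up to [x] as those of [qm] and [qp]. *)
Lemma jump_line F (v : R * R -> R) x (qm qp : {poly R}) (h : R) k : 0 < h ->
  (forall s : R, - h < s < 0 -> v (x + s *: normal F) = qm.[s]) ->
  (forall s : R, 0 < s < h -> v (x + s *: normal F) = qp.[s]) ->
  jump F (normal_derive F k v) x = qp^`(k).[0] - qm^`(k).[0].
Proof.
move=> h0 vm vp; rewrite /jump.
have nearh : \forall s \near (0 : R)^'+, 0 < s < h.
  by near=> s; apply/andP; split; near: s; [exact: nbhs_right_gt|exact: nbhs_right_lt].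
have cvg0 (q : {poly R}) : q^`(k).[s] @[s --> 0^'+] --> q^`(k).[0].
  by apply: cvg_at_right_filter; exact: continuous_horner.
have cvgN0 (q : {poly R}) : q^`(k).[- s] @[s --> 0^'+] --> q^`(k).[0].
  rewrite -[in X in _ --> X](oppr0 R); apply: cvg_at_right_filter.
  apply: (@continuous_comp _ _ _ -%R (horner q^`(k))); first exact: opp_continuous.
  exact: continuous_horner.
congr (_ - _); apply/cvg_lim => //.
  apply: cvg_trans (cvg0 qp); apply: near_eq_cvg.
  by apply: filterS nearh => s /(normal_derive_line k vp) ->.
apply: cvg_trans (cvgN0 qm); apply: near_eq_cvg; apply: filterS nearh => s sh.
by rewrite -scaleNr (normal_derive_line k vm)//; lra.
Unshelve. all: by end_near. Qed.

End Lines.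

(** * Norms over one cell *)

Section Boxes.
Context {R : realType}.
Variable p : nat.
Implicit Types (d : 'M[R]_p.+1) (a b h : R).

(* The cell with vertex [(a, b)] that lies left of [a] iff [e] and below [b] iff [f]. *)
Definition cell_at a b h (e f : bool) : set (R * R) :=
  closed_box a b h (- e%:R) (- f%:R).

Lemma interior_cell_at a b h e f :
  (cell_at a b h e f)° = open_box a b h (- e%:R) (- f%:R).
Proof. exact: interior_closed_box. Qed.

Lemma open_box_subset a b h u w : open_box a b h u w `<=` closed_box a b h u w.
Proof. by move=> x [/subset_itv_oo_cc x1 /subset_itv_oo_cc x2]. Qed.

Lemma scaled_cell_at_le1 a b h e f x : 0 < h -> cell_at a b h e f x ->
  `|(scaled a b h x).1| <= 1 /\ `|(scaled a b h x).2| <= 1.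
Proof.
move=> h0 [/= x1 x2].
have E c (g : bool) z : z \in `[(c + h * - g%:R), (c + h * (- g%:R + 1))] ->
    `|(z - c) / h| <= 1.
  rewrite in_itv/= => /andP[cz zc].
  rewrite normrM normfV (gtr0_norm h0) ler_pdivrMr// mul1r ler_norml.
  by apply/andP; case: g cz zc => /= cz zc; split; lra.
by split; [exact: E x1|exact: E x2].
Qed.

Lemma derive_tensor_poly a b h u w v d x : 0 < h ->
  (forall y, closed_box a b h u w y -> v y = tensor_poly d (scaled a b h y)) ->
  open_box a b h u w x ->
  'D_e1 v x = h^-1 * tensor_poly (deriv_mx p *m d) (scaled a b h x) /\
  'D_e2 v x = h^-1 * tensor_poly (d *m (deriv_mx p)^T) (scaled a b h x).
Proof.
move=> h0 vE [/= x1 x2]; split.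
- rewrite -deriv_line_poly.
  have -> : 'D_e1 v x = 'D_e1 v (x + 0 *: e1) by rewrite scale0r addr0.
  apply: derive_line.
  have := x1; rewrite in_itv/= => /andP[l1 r1].
  have : 0 \in `](a + h * u - x.1), (a + h * (u + 1) - x.1)[.
    by rewrite in_itv/=; apply/andP; split; lra.
  move=> /near_in_itvoo; apply: filterS => s; rewrite in_itv/= => /andP[ls sr].
  rewrite line_polyE vE /scaled/=.
    by congr (tensor_poly _ (_, _)); [rewrite -mulrDl; congr (_ / _)|congr (_ / _)];
      rewrite /GRing.scale/=; ring.
  split; last by apply: subset_itv_oo_cc; rewrite /= /GRing.scale/= mulr0 addr0.
  by rewrite /= in_itv/= /GRing.scale/= mulr1; apply/andP; split; lra.
(* Transposing the coefficients reduces the second variable to the first. *)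
- rewrite -tensor_poly_tr trmx_mul trmxK -deriv_line_poly.
  have -> : 'D_e2 v x = 'D_e2 v (x + 0 *: e2) by rewrite scale0r addr0.
  apply: derive_line.
  have := x2; rewrite in_itv/= => /andP[l2 r2].
  have : 0 \in `](b + h * w - x.2), (b + h * (w + 1) - x.2)[.
    by rewrite in_itv/=; apply/andP; split; lra.
  move=> /near_in_itvoo; apply: filterS => s; rewrite in_itv/= => /andP[ls sr].
  rewrite line_polyE tensor_poly_tr vE /scaled/=.
    by congr (tensor_poly _ (_, _)); [congr (_ / _)|rewrite -mulrDl; congr (_ / _)];
      rewrite /GRing.scale/=; ring.
  split; first by apply: subset_itv_oo_cc; rewrite /= /GRing.scale/= mulr0 addr0.
  by rewrite /= in_itv/= /GRing.scale/= mulr1; apply/andP; split; lra.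
Qed.

(** The coefficients of both partial derivatives in scaled coordinates. *)
Definition grad_coef_norm d : R :=
  coef_norm (deriv_mx p *m d) + coef_norm (d *m (deriv_mx p)^T).

Lemma grad_coef_normD_le c d :
  grad_coef_norm (c + d) <= 2 * grad_coef_norm c + 2 * grad_coef_norm d.
Proof.
rewrite /grad_coef_norm mulmxDr mulmxDl !mulrDr addrACA.
by rewrite lerD// coef_normD_le.
Qed.

Lemma grad_coef_norm_le d :
  grad_coef_norm d <= 2 * coef_norm (deriv_mx p : 'M[R]_p.+1) * coef_norm d.
Proof.
rewrite mulr_natl mulr2n mulrDl lerD ?coef_norm_mulmx_le//.
rewrite -[coef_norm (deriv_mx p)]coef_norm_tr mulrC.
exact: coef_norm_mulmx_le.
Qed.

Let M : R := (p.+1 * p.+1)%:R.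

Section OneCell.
Variables (a b h : R) (e f : bool) (v : R * R -> R) (d : 'M[R]_p.+1).
Hypothesis h0 : 0 < h.
Hypothesis vE : forall x, cell_at a b h e f x -> v x = tensor_poly d (scaled a b h x).

Let measurable_sqr (c : 'M[R]_p.+1) :
  measurable_fun [set: measurableTypeR R * measurableTypeR R]
    (fun x => tensor_poly c (scaled a b h x) ^+ 2).
Proof. by apply: measurable_funX; exact: measurable_tensor_poly. Qed.

Lemma L2norm_cell_sqr : (L2norm_cell (cell_at a b h e f) v ^+ 2 =
  \int[lebesgue2]_(x in cell_at a b h e f)
    (tensor_poly d (scaled a b h x) ^+ 2)%:E)%E.
Proof.
rewrite /L2norm_cell L2norm_sqr; apply: eq_integral => x; rewrite inE => xK.
by rewrite vE.
Qed.

Lemma L2norm_cell_le :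
  (L2norm_cell (cell_at a b h e f) v ^+ 2 <= (M * coef_norm d * h ^+ 2)%:E)%E.
Proof.
rewrite L2norm_cell_sqr; apply: (integral_box_le h0); first by right.
  exact: measurable_sqr.
move=> x /(scaled_cell_at_le1 h0)[x1 x2].
by rewrite sqr_ge0 sqr_tensor_poly_le.
Qed.

Lemma L2norm_grad_sqr : (L2norm_grad (cell_at a b h e f) v ^+ 2 =
  \int[lebesgue2]_(x in open_box a b h (- e%:R) (- f%:R))
    (h ^- 2 * (tensor_poly (deriv_mx p *m d) (scaled a b h x) ^+ 2 +
       tensor_poly (d *m (deriv_mx p)^T) (scaled a b h x) ^+ 2))%:E)%E.
Proof.
rewrite /L2norm_grad L2norm_sqr interior_cell_at.
apply: eq_integral => x; rewrite inE => xK.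
rewrite /grad_length sqr_sqrtr ?addr_ge0 ?sqr_ge0//.
have [-> ->] := derive_tensor_poly h0 vE xK.
by rewrite !exprMn -mulrDr exprVn.
Qed.

(** No power of [h] remains: the factor [h ^- 2] from the chain rule cancels the area [h ^+ 2] of
    the cell. *)
Lemma L2norm_grad_le :
  (L2norm_grad (cell_at a b h e f) v ^+ 2 <= (M * grad_coef_norm d)%:E)%E.
Proof.
have -> : M * grad_coef_norm d = (h ^- 2 * (M * grad_coef_norm d)) * h ^+ 2.
  by field; rewrite gt_eqF.
rewrite L2norm_grad_sqr; apply: (integral_box_le h0); first by left.
  apply: measurable_funM => //.
  by apply: measurable_funD; exact: measurable_sqr.
move=> x /open_box_subset/(scaled_cell_at_le1 h0)[x1 x2].
have hV : 0 <= h ^- 2 by rewrite invr_ge0 exprn_ge0// ltW.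
rewrite mulr_ge0 ?addr_ge0 ?sqr_ge0//=.
by rewrite ler_wpM2l// mulrDr lerD// sqr_tensor_poly_le.
Qed.

Variable m : R.
Hypothesis m_le : forall c : 'M[R]_p.+1,
  ((m * h ^+ 2 * coef_norm c)%:E <=
   \int[lebesgue2]_(x in open_box a b h (- e%:R) (- f%:R))
     (tensor_poly c (scaled a b h x) ^+ 2)%:E)%E.

Let measurable_open_box : measurable
  (open_box a b h (- e%:R) (- f%:R) : set (measurableTypeR R * measurableTypeR R)).
Proof. exact: (measurableX (measurable_itv _) (measurable_itv _)). Qed.

Lemma L2norm_cell_ge :
  ((m * h ^+ 2 * coef_norm d)%:E <= L2norm_cell (cell_at a b h e f) v ^+ 2)%E.
Proof.
apply: (le_trans (m_le d)); rewrite L2norm_cell_sqr.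
apply: ge0_subset_integral => //.
- exact: (measurableX (measurable_itv _) (measurable_itv _)).
- by apply: measurable_funTS; apply/measurable_EFinP; exact: measurable_sqr.
- by move=> x _; rewrite lee_fin sqr_ge0.
- exact: open_box_subset.
Qed.

Lemma L2norm_grad_ge :
  ((m * grad_coef_norm d)%:E <= L2norm_grad (cell_at a b h e f) v ^+ 2)%E.
Proof.
rewrite L2norm_grad_sqr.
under eq_integral do rewrite EFinM EFinD.
have mE (c : 'M[R]_p.+1) : measurable_fun (open_box a b h (- e%:R) (- f%:R)
      : set (measurableTypeR R * measurableTypeR R))
    (fun x => (tensor_poly c (scaled a b h x) ^+ 2)%:E).
  by apply: measurable_funTS; apply/measurable_EFinP; exact: measurable_sqr.
rewrite ge0_integralZl//; last 3 first.
- exact: emeasurable_funD.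
- by move=> x _; rewrite -EFinD lee_fin addr_ge0 ?sqr_ge0.
- by rewrite lee_fin invr_ge0 exprn_ge0// ltW.
rewrite ge0_integralD//; last 2 first.
- by move=> x _; rewrite lee_fin sqr_ge0.
- by move=> x _; rewrite lee_fin sqr_ge0.
have -> : m * grad_coef_norm d = h ^- 2 *
    (m * h ^+ 2 * coef_norm (deriv_mx p *m d) +
     m * h ^+ 2 * coef_norm (d *m (deriv_mx p)^T)).
  by rewrite /grad_coef_norm; field; rewrite gt_eqF.
rewrite EFinM EFinD; apply: lee_wpmul2l; last exact: leeD.
by rewrite lee_fin invr_ge0 exprn_ge0// ltW.
Qed.

End OneCell.

(** A cell has four possible positions relative to the base vertex; the minimum of the four
    constants serves them all. *)
Lemma integral_cell_at_ge : exists2 m : R, 0 < m &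
  forall a b h (e f : bool) d, 0 < h ->
  ((m * h ^+ 2 * coef_norm d)%:E <=
   \int[lebesgue2]_(x in open_box a b h (- e%:R) (- f%:R))
     (tensor_poly d (scaled a b h x) ^+ 2)%:E)%E.
Proof.
have H (e f : bool) := @integral_box_ge R p (- e%:R) (- f%:R).
have [m1 m10 H1] := H true true; have [m2 m20 H2] := H true false.
have [m3 m30 H3] := H false true; have [m4 m40 H4] := H false false.
exists (Num.min (Num.min m1 m2) (Num.min m3 m4)); first by rewrite !lt_min m10 m20 m30.
move=> a b h e f d h0.
have le_m m : Num.min (Num.min m1 m2) (Num.min m3 m4) <= m ->
    ((Num.min (Num.min m1 m2) (Num.min m3 m4) * h ^+ 2 * coef_norm d)%:E <=
     (m * h ^+ 2 * coef_norm d)%:E)%E.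
  by move=> mm; rewrite lee_fin !ler_wpM2r ?coef_norm_ge0 ?exprn_ge0// ltW.
by case: e; case: f; [move: (H1 a b h d h0)|move: (H2 a b h d h0)|
  move: (H3 a b h d h0)|move: (H4 a b h d h0)]; apply: le_trans; apply: le_m;
  rewrite !ge_min lexx ?orbT.
Qed.

End Boxes.

(** * The jump seminorm and the two cells of a face *)

Section Jumps.
Context {R : realType}.
Variable p : nat.

Lemma exists_lower_bound (gamma : nat -> R) :
  (forall k, (1 <= k <= p)%N -> 0 < gamma k) ->
  exists2 g, 0 < g & forall k, (1 <= k <= p)%N -> g <= gamma k.
Proof.
elim: p => [_|n IH gt0]; first by exists 1 => // k; case: k.
have [k /andP[k1 kn]|g g0 gle] := IH; first by rewrite gt0// k1 leqW.
exists (Num.min g (gamma n.+1)); first by rewrite lt_min g0 gt0/=.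
move=> k /andP[k1]; rewrite leq_eqVlt => /predU1P[->|kn].
  by rewrite ge_min lexx orbT.
by rewrite ge_min gle// k1 -ltnS.
Qed.

(** Applied to the difference of the coefficient matrices on the two cells, this handles order
    [k = 0], which the jump seminorm does not see. *)
Lemma tensor_poly_edge_eq0 (d : 'M[R]_p.+1) :
  (forall t, 0 <= t <= 1 -> tensor_poly d (0, t) = 0) ->
  forall j, d 0 j = 0.
Proof.
move=> d0 j; pose q : {poly R} := \poly_(j < p.+1) d 0 (inord j).
have -> : d 0 j = q`_j by rewrite coef_poly ltn_ord inord_val.
suff -> : q = 0 by rewrite coef0.
apply: (poly_eq0_segment ltr01) => t /d0 <-.
have := line_polyE d 1 0 t 0; rewrite mul0r addr0 => <-.
rewrite -[line_poly _ _ _ _]derivn0 (derivn_line_poly d 1 t ord0) horner_poly.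
by apply: eq_bigr => i _; rewrite inord_val fact0 expr0 invr1 !mul1r.
Qed.

Lemma jump_sqr_ge (D : 'M[R]_p.+1) (m g h : R) (k : 'I_p.+1) (J : R -> R)
    (gk : R) : 0 < h -> (0 < k)%N -> 0 <= m -> 0 <= g <= gk ->
  (forall q : {poly R}, (size q <= p.+1)%N ->
    ((m * h * \sum_(i < p.+1) q`_i ^+ 2)%:E <=
     \int[lebesgue_measure]_(s in `]0%R, h[) (q.[s / h] ^+ 2)%:E)%E) ->
  {in `[0, h], forall s, J s = \sum_(j < p.+1) (k`!%:R * h ^- k * D k j) * (s / h) ^+ j} ->
  ((g * m * \sum_j D k j ^+ 2)%:E <=
   (gk * h ^+ (2 * k - 1))%:E * L2norm (@lebesgue_measure R) `[0%R, h] J ^+ 2)%E.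
Proof.
move=> h0 k0 m0 /andP[g0 gk0] mP JE; rewrite L2norm_sqr.
pose q : {poly R} := \poly_(j < p.+1) (k`!%:R * h ^- k * D k (inord j)).
have -> : (\int[lebesgue_measure]_(s in `[0%R, h]) (J s ^+ 2)%:E =
    \int[lebesgue_measure]_(s in `]0%R, h[) (q.[s / h] ^+ 2)%:E)%E.
  rewrite -(@integral_itv_bndoo _ _ _ _ true false); last first.
    apply/measurable_EFinP; apply: measurable_funX; apply: measurable_funTS.
    apply: (@measurableT_comp _ _ _ _ _ _ (horner q)).
      by apply: continuous_measurable_fun; exact: continuous_horner.
    by apply: measurable_funM => //; exact: measurable_id.
  apply: eq_integral => s; rewrite inE => /JE ->; rewrite horner_poly.
  by congr ((_ ^+ 2)%:E); apply: eq_bigr => j _; rewrite inord_val.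
have gk00 : 0 <= gk by exact: le_trans gk0.
have gkh0 : 0 <= gk * h ^+ (2 * k - 1) by rewrite mulr_ge0 ?exprn_ge0 ?(ltW h0).
apply: le_trans (lee_wpmul2l _ (mP q (size_poly _ _))); last by rewrite lee_fin.
rewrite -EFinM lee_fin.
have -> : \sum_(i < p.+1) q`_i ^+ 2 = (k`!%:R * h ^- k) ^+ 2 * \sum_j D k j ^+ 2.
  rewrite mulr_sumr; apply: eq_bigr => i _.
  by rewrite coef_poly ltn_ord inord_val exprMn.
set S := \sum_j _.
have S0 : 0 <= S by apply: sumr_ge0 => j _; exact: sqr_ge0.
have -> : gk * h ^+ (2 * k - 1) * (m * h * ((k`!%:R * h ^- k) ^+ 2 * S)) =
    gk * m * S * k`!%:R ^+ 2.
  have hk : h ^+ (2 * k - 1) * h = (h ^+ k) ^+ 2.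
    by rewrite -exprSr -exprM subn1 prednK ?muln_gt0// mulnC.
  transitivity (gk * m * S * k`!%:R ^+ 2 * ((h ^+ (2 * k - 1) * h) * (h ^- k) ^+ 2)).
    by ring.
  by rewrite hk -exprMn divff ?expr1n ?mulr1// expf_neq0// gt_eqF.
have k1 : 1 <= k`!%:R ^+ 2 :> R by rewrite -natrX ler1n expn_gt0 fact_gt0.
apply: (@le_trans _ _ (gk * m * S)); first by rewrite !ler_wpM2r.
by rewrite ler_peMr// !mulr_ge0.
Qed.

Lemma sqr_jump_norm_ge (gamma : nat -> R) :
  (forall k, (1 <= k <= p)%N -> 0 < gamma k) ->
  exists2 m, 0 < m & forall N F v (dm dp : 'M[R]_p.+1), (0 < N)%N ->
  let h : R := mesh_size N in
  (forall s t, 0 <= t <= h -> - h <= s <= 0 ->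
    v (face_point N F t + s *: normal F) = tensor_poly dm (s / h, t / h)) ->
  (forall s t, 0 <= t <= h -> 0 <= s <= h ->
    v (face_point N F t + s *: normal F) = tensor_poly dp (s / h, t / h)) ->
  ((m * coef_norm (dp - dm))%:E <= sqr_jump_norm p gamma N F v)%E.
Proof.
move=> /exists_lower_bound[g g0 gle].
have [m m0 mP] := @integral_interval_ge R p.+1 0.
exists (g * m) => [|N F v dm dp N0 h vm vp]; first exact: mulr_gt0.
have h0 : 0 < h by rewrite invr_gt0 ltr0n.
set D := dp - dm.
(* Both polynomials equal [v] on the face itself, where [s = 0]. *)
have D0 : forall j, D 0 j = 0.
  apply: tensor_poly_edge_eq0 => t /andP[t0 t1].
  have th : 0 <= h * t <= h.
    by rewrite mulr_ge0 ?(ltW h0)//= ler_piMr// ltW.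
  have Em := vm 0 (h * t) th; have Ep := vp 0 (h * t) th.
  have -> : (0, t) = (0 / h, h * t / h) by rewrite mul0r mulrAC divff ?mul1r// gt_eqF.
  rewrite tensor_polyB -Em -?Ep ?subrr//; last by rewrite lexx oppr_le0 ltW.
  by rewrite lexx ltW.
rewrite /sqr_jump_norm.
(* Since row 0 of [D] vanishes, the rows from 1 to [p] carry the whole norm and match the terms of
   the seminorm one by one. *)
have -> : g * m * coef_norm D =
    \sum_(1 <= k < p.+1) g * m * \sum_j D (inord k) j ^+ 2.
  rewrite -mulr_sumr; congr (_ * _).
  transitivity (\sum_(0 <= k < p.+1) \sum_j D (inord k) j ^+ 2).
    by rewrite big_mkord; apply: eq_bigr => k _; rewrite inord_val.
  rewrite big_ltn// big1 ?add0r// => j _.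
  rewrite (_ : inord 0 = 0) ?D0 ?expr0n//.
  by apply: val_inj; rewrite /= inordK.
rewrite -sumEFin big_seq [leRHS]big_seq; apply: lee_sum => k.
rewrite mem_index_iota => /andP[k1 kp].
have -> : inord k = Ordinal kp by apply: val_inj; rewrite /= inordK.
apply: (jump_sqr_ge (k := Ordinal kp)) => //; first exact: ltW.
- by rewrite ltW//= gle// k1.
- move=> q szq; have := mP 0 h q h0 szq; rewrite !add0r mulr0 mulr1.
  by under eq_integral do rewrite subr0.
move=> s; rewrite in_itv/= => sh.
have lE (d : 'M[R]_p.+1) r : tensor_poly d (r / h, s / h) =
    (line_poly d h 0 (s / h)).[r] by rewrite line_polyE add0r.
rewrite /= (jump_line (h := h) (qm := line_poly dm h 0 (s / h))
  (qp := line_poly dp h 0 (s / h)))//.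
- rewrite !(derivn_line_poly _ _ _ (Ordinal kp)) -sumrB; apply: eq_bigr => j _.
  by rewrite /D !mxE -mulrBl -mulrBr.
- by move=> r /andP[hr r0]; rewrite -lE vm// !ltW.
- by move=> r /andP[hr r0]; rewrite -lE vp// !ltW.
Qed.

End Jumps.

(** * Position of the two cells relative to their common face *)

Section Faces.
Context {R : realType}.

Lemma cellE N i j fi fj (e f : bool) : (i + e = fi)%N -> (j + f = fj)%N ->
  cell N i j = @cell_at R (vertex N fi fj).1 (vertex N fi fj).2 (mesh_size N) e f.
Proof.
move=> <- <-; rewrite /cell /cell_at /closed_box /vertex/= !natrD.
have lE k (g : bool) (c : R) : (k%:R + g%:R) * c + c * - g%:R = k%:R * c by ring.
have rE k (g : bool) (c : R) :
  (k%:R + g%:R) * c + c * (- g%:R + 1) = k.+1%:R * c by rewrite -natr1; ring.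
by rewrite !lE !rE.
Qed.

Lemma cellP N i j x y : (0 < N)%N -> 
  @cell R N i j (x * mesh_size N, y * mesh_size N) <->
  (i%:R <= x <= i.+1%:R) /\ (j%:R <= y <= j.+1%:R).
Proof.
move=> N0; have h0 : 0 < mesh_size N :> R by rewrite invr_gt0 ltr0n.
by rewrite /cell /setX /= !in_itv/= !ler_pM2r.
Qed.

(** Both endpoints of the face lie in both cells, which in grid units gives inequalities between
    integers; together with the cells being distinct they fix all indices. [e] is true when the
    first cell is on the negative side of the face. *)
Lemma face_cells N i j i' j' F : (0 < N)%N ->
  cell N i j `&` cell N i' j' = @face_set R N F ->
  exists e : bool, if normal_to_x F
    then [/\ (i + e)%N = face_i F, (i' + ~~ e)%N = face_i F,
             j = face_j F & j' = face_j F]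
    else [/\ (j + e)%N = face_j F, (j' + ~~ e)%N = face_j F,
             i = face_i F & i' = face_i F].
Proof.
case: F => nx fi fj N0 KF.
have h0 : 0 < mesh_size N :> R by rewrite invr_gt0 ltr0n.
set h : R := mesh_size N in h0.
have face0 : face_set N (Face nx fi fj) (fi%:R * h, fj%:R * h).
  exists 0; first by rewrite /= in_itv/= lexx ltW.
  by rewrite /face_point scale0r addr0.
have face1 : face_set N (Face nx fi fj)
    ((fi + ~~ nx)%:R * h, (fj + nx)%:R * h).
  exists (h); first by rewrite /= in_itv/= lexx ltW.
  rewrite /face_point /vertex -/h /tangent/= !natrD.
  by case: nx {KF face0} => /=; congr (_, _); rewrite /=/GRing.scale/=; ring.
have faceP x y : face_set N (Face nx fi fj) (x * h, y * h) ->
    if nx then x = fi%:R else y = fj%:R.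
  move=> [s _]; rewrite /face_point /vertex -/h /tangent/=.
  by case: nx {KF face0 face1} => -[] + +; rewrite /GRing.scale/= mulr0 addr0;
    [move=> /(mulIf (lt0r_neq0 h0))|move=> _ /(mulIf (lt0r_neq0 h0))].
move: face0 face1; rewrite -KF => -[/(cellP _ _ _ _ N0) + /(cellP _ _ _ _ N0) +].
move=> + + [/(cellP _ _ _ _ N0) + /(cellP _ _ _ _ N0)].
rewrite !ler_nat => -[/andP[a1 a2] /andP[a3 a4]] [/andP[b1 b2] /andP[b3 b4]].
move=> -[/andP[c1 c2] /andP[c3 c4]] [/andP[d1 d2] /andP[d3 d4]].
(* If the cells coincided, the face would contain two opposite corners of a cell. These differ in
   both coordinates, whereas the normal coordinate is constant on a face. *)
have Kii : (i, j) != (i', j').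
  apply/eqP => -[ii jj]; rewrite -ii -jj setIid in KF.
  have P0 : cell N i j (i%:R * h, j%:R * h).
    by apply/cellP; rewrite // !ler_nat !leqnn !leqnSn.
  have P1 : cell N i j (i.+1%:R * h, j.+1%:R * h).
    by apply/cellP; rewrite // !ler_nat !leqnn !leqnSn.
  move: P0 P1; rewrite KF => /faceP + /faceP.
  by case: nx {KF faceP a1 a2 a3 a4 b1 b2 b3 b4 c1 c2 c3 c4 d1 d2 d3 d4} => <- /eqP;
    rewrite eqr_nat => /eqP; lia.
move: Kii; rewrite xpair_eqE.
case: nx {KF faceP} a1 a2 a3 a4 b1 b2 b3 b4 c1 c2 c3 c4 d1 d2 d3 d4 => /= *;
  [exists (i != fi)|exists (j != fj)]; split; lia.
Qed.

Lemma scaled_face_point N F s t : (0 < N)%N ->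
  scaled (vertex N (face_i F) (face_j F)).1 (vertex N (face_i F) (face_j F)).2
    (mesh_size N) (face_point N F t + s *: normal F) =
  if normal_to_x F then (s / mesh_size N, t / mesh_size N)
  else (t / mesh_size N, s / mesh_size N) :> R * R.
Proof.
move=> N0; rewrite /scaled /face_point /tangent /normal.
by case: ifPn => _; congr (_ / _, _ / _); rewrite /= /GRing.scale/=; ring.
Qed.

Lemma face_point_cell_at N F (e : bool) (s t : R) : (0 < N)%N ->
  0 <= t <= mesh_size N ->
  (if e then - mesh_size N <= s <= 0 else 0 <= s <= mesh_size N) ->
  cell_at (vertex N (face_i F) (face_j F)).1 (vertex N (face_i F) (face_j F)).2
    (mesh_size N) (normal_to_x F && e) (~~ normal_to_x F && e)
    (face_point N F t + s *: normal F).
Proof.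
move=> N0 /andP[t0 t1] se; rewrite /face_point /tangent /normal.
have {}se : mesh_size N * - e%:R <= s <= mesh_size N * (- e%:R + 1).
  by case: e se => /andP[s0 s1]; apply/andP; split; rewrite /=; lra.
case/andP: se => s0 s1.
by case: ifPn => _; split; rewrite /= in_itv/= /GRing.scale/=; apply/andP; split;
  rewrite /=; lra.
Qed.

End Faces.

(** * Assembling the two estimates *)

Section Extension.
Context {R : realType}.
Variable p : nat.

(** Reduction of all configurations to one: transposition makes the normal the first axis, and
    [coef_norm] ignores the sign of the difference, so the order of the cells does not matter. *)
Lemma sqr_jump_norm_cells_ge (gamma : nat -> R) :
  (forall k, (1 <= k <= p)%N -> 0 < gamma k) ->
  exists2 g, 0 < g & forall N F v (d1 d2 : 'M[R]_p.+1) (e : bool), (0 < N)%N ->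
  let a := (vertex N (face_i F) (face_j F)).1 in
  let b := (vertex N (face_i F) (face_j F)).2 in
  let h := mesh_size N in
  (forall x, cell_at a b h (normal_to_x F && e) (~~ normal_to_x F && e) x ->
    v x = tensor_poly d1 (scaled a b h x)) ->
  (forall x, cell_at a b h (normal_to_x F && ~~ e) (~~ normal_to_x F && ~~ e) x ->
    v x = tensor_poly d2 (scaled a b h x)) ->
  ((g * coef_norm (d1 - d2))%:E <= sqr_jump_norm p gamma N F v)%E.
Proof.
move=> /sqr_jump_norm_ge[g g0 gP]; exists g => // N F v d1 d2 e N0 a b h v1 v2.
pose o (d : 'M[R]_p.+1) := if normal_to_x F then d else d^T.
have oE d s t : tensor_poly (o d) (s / h, t / h) =
    tensor_poly d (scaled a b h (face_point N F t + s *: normal F)).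
  by rewrite scaled_face_point// /o; case: ifPn => // _; rewrite tensor_poly_tr.
have oB c d : coef_norm (o c - o d) = coef_norm (c - d).
  by rewrite /o; case: ifPn => // _; rewrite -linearB coef_norm_tr.
case: e v1 v2 => v1 v2.
  rewrite -coef_normN opprB -oB; apply: gP => // s t th sh; rewrite oE.
    by rewrite v1//; exact: face_point_cell_at.
  by rewrite v2//; exact: face_point_cell_at.
rewrite -oB; apply: gP => // s t th sh; rewrite oE.
  by rewrite v2//; exact: face_point_cell_at.
by rewrite v1//; exact: face_point_cell_at.
Qed.

(** On [K1] and [K2] both extensions by zero leave the underlying mesh function unchanged, so its
    polynomial representation on each cell is inherited. *)
Lemma restrict_active_space Omega N (K1 K2 : set (R * R)) v :
  active_mesh Omega N K1 -> active_mesh Omega N K2 ->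
  restrict_space (K1 `|` K2) (active_space p Omega N) v ->
  (exists c : 'M[R]_p.+1, forall x, K1 x -> v x = tensor_poly c x) /\
  (exists c : 'M[R]_p.+1, forall x, K2 x -> v x = tensor_poly c x).
Proof.
move=> aK1 aK2 [_ [w [_ wE] <-] <-].
have vw K x : active_mesh Omega N K -> K `<=` K1 `|` K2 -> K x ->
    ((w \_ (\bigcup_(K in active_mesh Omega N) K)) \_ (K1 `|` K2)) x = w x.
  move=> aK KK Kx; rewrite patchE mem_set; last exact: KK.
  by rewrite patchE mem_set//; exists K.
split.
  have [c cE] := wE _ aK1.1; exists c => x Kx.
  by rewrite (vw K1)// ?cE ?inE// => y; left.
have [c cE] := wE _ aK2.1; exists c => x Kx.
by rewrite (vw K2)// ?cE ?inE// => y; right.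
Qed.

Lemma lee_mul_add (X Y Z : \bar R) (x y z C : R) : 0 <= C ->
  (X <= x%:E)%E -> (y%:E <= Y)%E -> (z%:E <= Z)%E -> x <= C * (y + z) ->
  (X <= C%:E * (Y + Z))%E.
Proof.
move=> C0 Xx yY zZ xyz; apply: (le_trans Xx).
apply: (@le_trans _ _ (C%:E * (y + z)%:E)%E); first by rewrite -EFinM lee_fin.
by rewrite EFinD; apply: lee_wpmul2l; [rewrite lee_fin|exact: leeD].
Qed.

End Extension.

Theorem lemma4p1 (R : realType) (Omega : set (R * R))
    (Omega_square : Omega `<=` unit_square)
    (p : nat) (p_ge1 : (1 <= p)%N)
    (gamma : nat -> R)
    (gamma_gt0 : forall k : nat, (1 <= k <= p)%N -> 0 < gamma k) :
  exists C : R,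
    forall (N : nat) (K1 K2 : set (R * R)) (F : face),
      (0 < N)%N ->
      active_mesh Omega N K1 -> active_mesh Omega N K2 ->
      K1 `&` K2 = face_set N F ->
      forall v : R * R -> R,
        restrict_space (K1 `|` K2) (active_space p Omega N) v ->
        (L2norm_grad K1 v ^+ 2 <=
           C%:E * (L2norm_grad K2 v ^+ 2 + sqr_jump_norm p gamma N F v))%E /\
        (L2norm_cell K1 v ^+ 2 <=
           C%:E * (L2norm_cell K2 v ^+ 2 +
                   (mesh_size N ^+ 2)%:E * sqr_jump_norm p gamma N F v))%E.
Proof.
have [m m0 mP] := @integral_cell_at_ge R p.
have [g g0 gP] := sqr_jump_norm_cells_ge gamma_gt0.
pose M : R := (p.+1 * p.+1)%:R; pose L := coef_norm (deriv_mx p : 'M[R]_p.+1).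
have M0 : 0 <= M by [].
have L0 : 0 <= L by exact: coef_norm_ge0.
(* One summand per requirement: [2 * M <= C * m] for the contribution of [d2] in both estimates,
   [2 * M <= C * g] for the jump in the value estimate, and [4 * M * L <= C * g] for the jump in the
   gradient estimate, where [grad_coef_norm_le] costs a further [2 * L]. *)
pose C := 2 * M / m + 2 * M / g + 4 * M * L / g.
have [C1 C2 C3] : [/\ 0 <= 2 * M / m, 0 <= 2 * M / g & 0 <= 4 * M * L / g].
  by split; rewrite divr_ge0 ?mulr_ge0// ltW.
have C0 : 0 <= C by rewrite !addr_ge0.
have Cm : 2 * M <= C * m by rewrite -ler_pdivrMr// /C -addrA lerDl addr_ge0.
have Cg : 2 * M <= C * g by rewrite -ler_pdivrMr// /C addrAC lerDr addr_ge0.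
have CLg : 4 * M * L <= C * g by rewrite -ler_pdivrMr// /C lerDr addr_ge0.
exists C => N K1 K2 F N0 aK1 aK2 KF v vV.
have [[c1 v1] [c2 v2]] := restrict_active_space aK1 aK2 vV.
case: aK1 aK2 => [[i [j [_ _ K1E]]] _] [[i' [j' [_ _ K2E]]] _].
have [e eF] : exists e : bool, if normal_to_x F
    then [/\ (i + e)%N = face_i F, (i' + ~~ e)%N = face_i F,
             j = face_j F & j' = face_j F]
    else [/\ (j + e)%N = face_j F, (j' + ~~ e)%N = face_j F,
             i = face_i F & i' = face_i F].
  by apply: (@face_cells R N) => //; rewrite -K1E -K2E.
pose h : R := mesh_size N; have h0 : 0 < h by rewrite invr_gt0 ltr0n.
pose a : R := (vertex N (face_i F) (face_j F)).1.
pose b : R := (vertex N (face_i F) (face_j F)).2.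
have {}K1E : K1 = cell_at a b h (normal_to_x F && e) (~~ normal_to_x F && e).
  by rewrite K1E; apply: cellE; case: normal_to_x eF => -[]; rewrite ?addn0.
have {}K2E : K2 = cell_at a b h (normal_to_x F && ~~ e) (~~ normal_to_x F && ~~ e).
  by rewrite K2E; apply: cellE; case: normal_to_x eF => -[]; rewrite ?addn0.
have [d1 d1E] := tensor_poly_scaled c1 a b (lt0r_neq0 h0).
have [d2 d2E] := tensor_poly_scaled c2 a b (lt0r_neq0 h0).
have {}v1 x : K1 x -> v x = tensor_poly d1 (scaled a b h x).
  by move=> /v1 ->; exact: d1E.
have {}v2 x : K2 x -> v x = tensor_poly d2 (scaled a b h x).
  by move=> /v2 ->; exact: d2E.
rewrite K1E in v1 *; rewrite K2E in v2 *.
have J := gP N F v d1 d2 e N0 v1 v2.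
have d1D : d1 = d2 + (d1 - d2) by rewrite addrC subrK.
set D := d1 - d2 in J d1D.
have E2 := coef_norm_ge0 d2; have ED := coef_norm_ge0 D.
split.
- apply: (lee_mul_add C0 (L2norm_grad_le h0 v1)
    (L2norm_grad_ge h0 v2 (fun c => mP _ _ _ _ _ c h0)) J).
  have G1 := grad_coef_normD_le d2 D; rewrite -d1D in G1.
  have GD := grad_coef_norm_le D; rewrite -/L in GD.
  have G2 : 0 <= grad_coef_norm d2 by rewrite addr_ge0 ?coef_norm_ge0.
  apply: (@le_trans _ _ (2 * M * grad_coef_norm d2 + 4 * M * L * coef_norm D)).
    have := ler_wpM2l M0 (le_trans G1 (lerD (lexx _) (ler_wpM2l (ler0n R 2) GD))).
    by move=> /le_trans; apply; rewrite le_eqVlt; apply/orP; left; apply/eqP; ring.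
  have -> : C * (m * grad_coef_norm d2 + g * coef_norm D) =
    C * m * grad_coef_norm d2 + C * g * coef_norm D by ring.
  by rewrite lerD// ler_wpM2r.
(* The weight [h ^+ 2] on the seminorm matches the area factor in both cell norms, so [h ^+ 2] can
   be factored out. *)
- have {}J : ((h ^+ 2 * (g * coef_norm D))%:E <=
      (h ^+ 2)%:E * sqr_jump_norm p gamma N F v)%E.
    by rewrite EFinM lee_wpmul2l// lee_fin exprn_ge0// ltW.
  apply: (lee_mul_add C0 (L2norm_cell_le h0 v1)
    (L2norm_cell_ge v2 (fun c => mP _ _ _ _ _ c h0)) J).
  have := coef_normD_le d2 D; rewrite -d1D => E1.
  have -> : C * (m * h ^+ 2 * coef_norm d2 + h ^+ 2 * (g * coef_norm D)) =
    (C * m * coef_norm d2 + C * g * coef_norm D) * h ^+ 2 by ring.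
  rewrite ler_wpM2r ?exprn_ge0 ?(ltW h0)//.
  apply: (le_trans (ler_wpM2l M0 E1)).
  have -> : M * (2 * coef_norm d2 + 2 * coef_norm D) =
    2 * M * coef_norm d2 + 2 * M * coef_norm D by ring.
  by rewrite lerD// ler_wpM2r.
Qed.
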